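(* Let $\epsilon>0$. Let $X=\{x\in\mathbb{R}^n:Ax\le b,\ x\ge0\}$ be a nonempty rational polyhedron with $A\in\mathbb{Q}^{m\times n}$ and $b\in\mathbb{Q}^m$, and let $\phi:\mathbb{R}^n_+\to\mathbb{R}_+$, $\phi(x)=\sum_{i=1}^n\phi_i(x_i)$, be a nondecreasing separable concave function whose components $\phi_i$ are nonnegative. Let $\psi=\sum_{i=1}^n\psi_i$ be the piecewise-linear function built from $\phi$, $A$, $b$, $\epsilon$ as described in the context, and let $Z^*_{\mathrm{conc}}=\min\{\phi(x):Ax\le b,\ x\ge0\}$ and $Z^*_{\mathrm{pwl}}=\min\{\psi(x):Ax\le b,\ x\ge0\}$. Then $$Z^*_{\mathrm{conc}}\le Z^*_{\mathrm{pwl}}\le(1+\epsilon)Z^*_{\mathrm{conc}}.$$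
   Context: $\mathbb{R}_+=[0,+\infty)$; each $\phi_i:\mathbb{R}_+\to\mathbb{R}_+$ is concave and nondecreasing. Sizes: for an integer $r$, $\mathrm{size}(r)=1+\lceil\log_2(|r|+1)\rceil$; for a rational $r=r_1/r_2$ with $r_2>0$ and $r_1,r_2$ coprime integers, $\mathrm{size}(r)=\mathrm{size}(r_1)+\mathrm{size}(r_2)$; for a rational vector or matrix $M\in\mathbb{Q}^{p\times q}$ with entries $m_{ij}$, $\mathrm{size}(M)=pq+\sum_{i,j}\mathrm{size}(m_{ij})$. Let $U(A,b)=4(\mathrm{size}(A)+\mathrm{size}(b)+2n^2+3n)$. Construction of $\psi$: for every $i$ let $l_i=\frac{1}{2^{U(A,b)-1}-1}$, $u_i=2^{U(A,b)-1}-1$ and $P_i=\lceil\log_{1+4\epsilon+4\epsilon^2}(u_i/l_i)\rceil$. For $p\in\{0,\dots,P_i\}$ let $\xi_i^p=l_i(1+4\epsilon+4\epsilon^2)^p$, $s_i^p=\phi_i'(\xi_i^p)$ and $f_i^p=\phi_i(\xi_i^p)-\xi_i^ps_i^p$, where $\phi_i'$ is the derivative, or the right derivative where the derivative does not exist. For $x_i>0$ put $\psi_i(x_i)=\min\{f_i^p+s_i^px_i:p=0,\dots,P_i\}$, put $\psi_i(0)=\phi_i(0)$, and let $\psi(x)=\sum_{i=1}^n\psi_i(x_i)$. (Thus each $\psi_i$ is composed of $P_i+1$ lines.) *)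

(* Defs.v *)
(* MathComp / MathComp-Analysis. *)
From mathcomp Require Import all_boot all_order all_algebra.
From mathcomp Require Import all_classical all_reals all_analysis.

Set Implicit Arguments.
Unset Strict Implicit.
Unset Printing Implicit Defensive.

Import Order.TTheory GRing.Theory Num.Theory numFieldNormedType.Exports.

Local Open Scope classical_set_scope.
Local Open Scope ring_scope.

(* For k >= 1, [up_log 2 k] is the ceiling of log_2 k. *)
Definition int_size (r : int) : nat := (1 + up_log 2 (`|r| + 1))%N.

(* [numq r / denq r] is the reduced form of [r], with [denq r > 0]; an
   integer-valued rational r is read as r / 1. *)
Definition rat_size (r : rat) : nat := (int_size (numq r) + int_size (denq r))%N.

Definition mx_size (p q : nat) (M : 'M[rat]_(p, q)) : nat :=
  (p * q + \sum_(i < p) \sum_(j < q) rat_size (M i j))%N.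

Definition size_bound (m n : nat) (A : 'M[rat]_(m, n)) (b : 'cV[rat]_m) : nat :=
  (4 * (mx_size A + mx_size b + 2 * n ^ 2 + 3 * n))%N.

Definition polyhedron (R : realType) (m n : nat)
    (A : 'M[rat]_(m, n)) (b : 'cV[rat]_m) : set 'cV[R]_n :=
  [set x | (forall i, (map_mx ratr A *m x) i 0 <= ratr (b i 0)) /\
           (forall j, 0 <= x j 0)].
Arguments polyhedron R {m n} A b _.

Definition concave_function (R : realType) (D : set R) (f : R -> R) : Prop :=
  convex_function D (fun x => - f x).

(* The components are total functions R -> R, of which only the restriction to
   [0, +oo[ matters. *)
Definition separable (R : realType) (n : nat) (f : 'I_n -> R -> R)
    (x : 'cV[R]_n) : R :=
  \sum_(i < n) f i (x i 0).

Definition is_minimum (R : realType) (S : set R) (z : R) : Prop :=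
  S z /\ lbound S z.

Definition right_derivative (R : realType) (f : R -> R) (x : R) : R :=
  lim (h^-1 * (f (x + h) - f x) @[h --> 0^'+]).

Definition deriv_or_right (R : realType) (f : R -> R) (x : R) : R :=
  if `[< derivable f x 1 >] then f^`()%classic x else right_derivative f x.

(* [U] is used only with [U = size_bound A b], which is at least 20 as soon as
   n >= 1, that is, as soon as there is a component to approximate; hence
   neither the truncated [U.-1] nor the inverse is degenerate. *)
Definition grid_hi (R : realType) (U : nat) : R := 2 ^+ U.-1 - 1.
Definition grid_lo (R : realType) (U : nat) : R := (2 ^+ U.-1 - 1)^-1.

Definition grid_ratio (R : realType) (eps : R) : R := 1 + 4 * eps + 4 * eps ^+ 2.

(* The ceiling is nonnegative, since grid_lo <= grid_hi and grid_ratio > 1, so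
   the absolute value only serves to convert from int to nat. *)
Definition grid_num (R : realType) (U : nat) (eps : R) : nat :=
  `|Num.ceil (ln (grid_hi R U / grid_lo R U) / ln (grid_ratio eps))|%N.

Definition grid_pt (R : realType) (U : nat) (eps : R) (p : nat) : R :=
  grid_lo R U * grid_ratio eps ^+ p.

Definition slope (R : realType) (U : nat) (eps : R) (f : R -> R) (p : nat) : R :=
  deriv_or_right f (grid_pt U eps p).

Definition intercept (R : realType) (U : nat) (eps : R) (f : R -> R)
    (p : nat) : R :=
  f (grid_pt U eps p) - grid_pt U eps p * slope U eps f p.

(* In the minimum over p = 0, ..., grid_num, line 0 also serves as the default
   value of the iterated [Num.min]. *)
Definition pwl (R : realType) (U : nat) (eps : R) (f : R -> R) (x : R) : R :=
  let line p := intercept U eps f p + slope U eps f p * x in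
  if x == 0 then f 0
  else \big[Num.min/line 0%N]_(0 <= p < (grid_num U eps).+1) line p.

(* Main.v *)
(** A concave nondecreasing separable function on a polyhedron in the
    nonnegative orthant is minimized at a basic feasible solution: from a
    non-basic point one can move both ways along a line inside the active
    constraints, and one of the two ends is no worse.  By Cramer's rule, after
    clearing denominators row by row, a nonzero coordinate of a basic solution
    is a quotient of two integers between 1 and 2^(size A + size b), hence lies
    between the extreme grid points.  There two consecutive grid points a and
    c = (1 + 2 eps)^2 a enclose the coordinate x, and comparing the tangents at
    a and c with the chord between them costs at most a factor 1 + eps.  Thus
    psi <= (1 + eps) phi at the basic minimizer of phi, while phi <= psi
    everywhere because tangents lie above concave functions. *)
Require Import Defs.
From mathcomp Require Import all_boot all_order all_algebra.
From mathcomp Require Import all_classical all_reals all_analysis.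
From mathcomp Require Import ring lra zify.

Set Implicit Arguments.
Unset Strict Implicit.
Unset Printing Implicit Defensive.

Import Order.TTheory GRing.Theory Num.Theory numFieldNormedType.Exports.

Local Open Scope classical_set_scope.
Local Open Scope ring_scope.

(** * Concave functions on the half-line: chords, right derivatives and tangents *)

Lemma concave_functionP (R : realType) (f : R -> R) :
  concave_function `[0, +oo[%classic f <->
  forall x y t : R, 0 <= x -> 0 <= y -> 0 <= t -> t <= 1 ->
    t * f x + (1 - t) * f y <= f (t * x + (1 - t) * y).
Proof.
have D z : (z \in (`[0, +oo[%classic : set R)) = (0 <= z).
  by rewrite mem_setE in_itv /= andbT.
split=> [fc x y t x0 y0 t0 t1|fc t x y].
  have := fc (Itv01 t0 t1) x y.
  by rewrite !D x0 y0 -(convN (f x) (f y)) lerN2 !convRE => /(_ isT isT).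
rewrite !D => x0 y0; rewrite -(convN (f x) (f y)) lerN2 !convRE.
exact: fc.
Qed.

(** Here [y] is the convex combination of [x] and [z] with weights [(z - y) / (z - x)] and
    [(y - x) / (z - x)]. Multiplying out the denominator keeps the degenerate case [x = y = z] and
    leaves an inequality fit for [lra] and [nra]. *)
Lemma concave_chord (R : realType) (f : R -> R) (x y z : R) :
  concave_function `[0, +oo[%classic f -> 0 <= x -> x <= y -> y <= z ->
  (z - y) * f x + (y - x) * f z <= (z - x) * f y.
Proof.
move=> fc x0 xy yz.
have [xz|] := ltP x z; last first.
  move=> zx; have -> : x = y by lra.
  have -> : z = y by lra.
  by rewrite subrr !mul0r addr0.
have zx0 : 0 < z - x by rewrite subr_gt0.
have := (concave_functionP f).1 fc x z ((z - y) / (z - x)) x0.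
have -> : 1 - (z - y) / (z - x) = (y - x) / (z - x) by field; lra.
have -> : (z - y) / (z - x) * x + (y - x) / (z - x) * z = y by field; lra.
have -> : (z - y) / (z - x) * f x + (y - x) / (z - x) * f z =
   ((z - y) * f x + (y - x) * f z) / (z - x) by field; lra.
rewrite !ler_pdivrMr// mul1r [f y * _]mulrC; apply; first lra.
  by rewrite divr_ge0 ?subr_ge0// ltW// -subr_gt0.
by lra.
Qed.

(** Gives meaning to the [lim] in [right_derivative]: the difference quotient is nonincreasing in
    [h] and bounded above by the slope of the chord from 0 to [x], which exists because [0 < x]. *)
Lemma deriv_or_right_cvg (R : realType) (f : R -> R) (x : R) :
  concave_function `[0, +oo[%classic f -> 0 < x ->
  h^-1 * (f (x + h) - f x) @[h --> 0^'+] --> deriv_or_right f x.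
Proof.
move=> fc x0; rewrite /deriv_or_right.
case: asboolP => [fx|_].
  have := @cvg_dnbhs_at_right _ _ _ _ _ fx; rewrite derive1E /derive.
  have -> : (fun h : R => h^-1 *: ((f \o shift x) (h *: (1 : R)) - f x)) =
            (fun h => h^-1 * (f (x + h) - f x)).
    by apply/funext => h /=; rewrite [h%:A]mulr1 [h + x]addrC.
  by [].
suff : cvg (h^-1 * (f (x + h) - f x) @[h --> 0^'+]) by [].
apply: nonincreasing_at_right_is_cvgr.
  near=> e => k h; rewrite !in_itv /= => /andP[k0 _] /andP[h0 _] kh.
  rewrite ![_^-1 * _]mulrC ler_pdivlMr// mulrAC ler_pdivrMr//.
  have := @concave_chord R f x (x + k) (x + h) fc (ltW x0).
  by rewrite ler_wpDr ?(ltW k0)// lerD2l => /(_ isT kh); lra.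
near=> e; exists ((f x - f 0) / x) => _ /= [h + <-].
rewrite in_itv /= => /andP[h0 _].
rewrite ![_^-1 * _]mulrC ler_pdivlMr// mulrAC ler_pdivrMr//.
have := @concave_chord R f 0 x (x + h) fc (lexx 0) (ltW x0).
by rewrite ler_wpDr ?(ltW h0)// => /(_ isT); lra.
Unshelve. all: by end_near. Qed.

(** On either side of [x], the chord inequality compares the right difference quotients with the
    slope of the chord between [x] and [y]; the comparison passes to the limit. *)
Lemma le_tangent (R : realType) (f : R -> R) (x y : R) :
  concave_function `[0, +oo[%classic f -> 0 < x -> 0 <= y ->
  f y <= f x + deriv_or_right f x * (y - x).
Proof.
move=> fc x0 y0.
have qcvg := deriv_or_right_cvg fc x0.
have [yx|xy|->] := ltgtP y x; last by rewrite subrr mulr0 addr0.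
- suff : deriv_or_right f x <= (f x - f y) / (x - y).
    by rewrite ler_pdivlMr ?subr_gt0//; lra.
  rewrite -(cvg_lim _ qcvg)//; apply: limr_le.
    by apply/cvg_ex; exists (deriv_or_right f x).
  near=> h; have h0 : 0 < h by near: h; exact: nbhs_right_gt.
  rewrite [_^-1 * _]mulrC ler_pdivlMr ?subr_gt0// mulrAC ler_pdivrMr//.
  have := @concave_chord R f y x (x + h) fc y0 (ltW yx).
  by rewrite ler_wpDr ?(ltW h0)// => /(_ isT); lra.
- suff : (f y - f x) / (y - x) <= deriv_or_right f x.
    by rewrite ler_pdivrMr ?subr_gt0//; lra.
  rewrite -(cvg_lim _ qcvg)//; apply: limr_ge.
    by apply/cvg_ex; exists (deriv_or_right f x).
  near=> h; have h0 : 0 < h by near: h; exact: nbhs_right_gt.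
  have hy : h < y - x by near: h; apply: nbhs_right_lt; rewrite subr_gt0.
  rewrite [_^-1 * _]mulrC ler_pdivlMr// mulrAC ler_pdivrMr ?subr_gt0//.
  have := @concave_chord R f x (x + h) y fc (ltW x0).
  by rewrite ler_wpDr ?(ltW h0)// => /(_ isT); lra.
Unshelve. all: by end_near. Qed.

Lemma deriv_or_right_ge0 (R : realType) (f : R -> R) (x : R) :
  concave_function `[0, +oo[%classic f ->
  {in `[0, +oo[ &, nondecreasing_fun f} -> 0 < x -> 0 <= deriv_or_right f x.
Proof.
move=> fc fi x0.
have x10 : 0 <= x + 1 by lra.
have := le_tangent fc x0 x10.
have : f x <= f (x + 1) by apply: fi; rewrite ?in_itv /= ?andbT; lra.
by lra.
Qed.

(* The worst case is [x = sqrt (a * c) = g * a]: AM-GM bounds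
   [a * c / x + x] from below by [2 * g * a]. *)
Lemma min_tangent_le (R : realType) (f : R -> R) (a c g x : R) :
  concave_function `[0, +oo[%classic f ->
  {in `[0, +oo[ &, nondecreasing_fun f} -> 0 <= f 0 ->
  0 < a -> 1 < g -> c = a * g ^+ 2 -> a <= x -> x <= c ->
  Num.min (f a + deriv_or_right f a * (x - a))
          (f c + deriv_or_right f c * (x - c)) <= (1 + g) / 2 * f x.
Proof.
move=> fc fi f0 a0 g1 cE ax xc.
have c0 : 0 < c by nra.
have x0 : 0 < x by lra.
set la := f a + _; set lc := f c + _; set mu := Num.min la lc.
(* The tangent at [a] is nonnegative at 0, so beyond [a] it stays below the ray from the origin
   through [(a, f a)]. *)
have lac : mu * a <= f a * x.
  have : mu <= la by rewrite ge_min lexx.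
  have := le_tangent fc a0 (lexx 0).
  rewrite /la; set s := deriv_or_right f a => ? ?.
  by nra.
have lcc : mu <= f c.
  have : mu <= lc by rewrite ge_min lexx orbT.
  have := deriv_or_right_ge0 fc fi c0.
  by rewrite /lc; nra.
have key := concave_chord fc (ltW a0) ax xc.
have [mu0|mu0] := leP mu 0.
  apply: (le_trans mu0); apply: mulr_ge0; first by lra.
  by apply: (le_trans f0); apply: fi; rewrite ?in_itv /= ?andbT; lra.
(* The chord inequality with [f a] and [f c] replaced by their lower bounds [mu * a / x] and [mu],
   multiplied by [x]. *)
have h1 : mu * (c - x) * a + mu * (x - a) * x <= (c - a) * f x * x.
  have : (c - x) * (mu * a) <= (c - x) * (f a * x).
    by apply: ler_wpM2l => //; lra.
  have : (x - a) * x * mu <= (x - a) * x * f c.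
    by apply: ler_wpM2l => //; apply: mulr_ge0; lra.
  have : ((c - x) * f a + (x - a) * f c) * x <= (c - a) * f x * x.
    by apply: ler_wpM2r => //; lra.
  by lra.
have h2 : mu * (2 * a * x * (g - 1)) <= mu * ((c - x) * a + (x - a) * x).
  apply: ler_wpM2l; first lra.
  have := sqr_ge0 (a * g - x); rewrite cE; lra.
have ax0 : 0 < a * x * (g - 1) by rewrite !mulr_gt0// subr_gt0.
rewrite -(ler_pM2l ax0); move: h1 h2; rewrite cE; lra.
Qed.

(** * The geometric grid and the piecewise-linear approximation *)

Lemma grid_hi_ge1 (R : realType) (U : nat) : (1 < U)%N -> 1 <= grid_hi R U.
Proof.
case: U => [|[|U]]// _; rewrite /grid_hi /= exprS.
have : 1 <= (2 : R) ^+ U by rewrite exprn_ege1// ler1n.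
by lra.
Qed.

(** The square supplies [g = 1 + 2 * eps] in [min_tangent_le], whose factor [(1 + g) / 2] is then
    exactly [1 + eps]. *)
Lemma grid_ratioE (R : realType) (eps : R) :
  grid_ratio eps = (1 + 2 * eps) ^+ 2.
Proof. by rewrite /grid_ratio; ring. Qed.

Lemma grid_pt_gt0 (R : realType) (U : nat) (eps : R) (p : nat) :
  (1 < U)%N -> 0 < eps -> 0 < grid_pt U eps p.
Proof.
move=> U1 e0; rewrite /grid_pt mulr_gt0//.
  by rewrite invr_gt0; exact: lt_le_trans ltr01 (grid_hi_ge1 R U1).
by rewrite exprn_gt0// grid_ratioE exprn_gt0//; lra.
Qed.

(** In logarithms this says that a number is at most its ceiling. As grid point 0 is [grid_lo], the
    grid covers everything between [grid_lo] and [grid_hi]. *)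
Lemma grid_hi_le (R : realType) (U : nat) (eps : R) :
  (1 < U)%N -> 0 < eps -> grid_hi R U <= grid_pt U eps (grid_num U eps).
Proof.
move=> U1 e0.
have hi0 : 0 < grid_hi R U by exact: lt_le_trans ltr01 (grid_hi_ge1 R U1).
have lo0 : 0 < grid_lo R U by rewrite invr_gt0.
have r1 : 1 < grid_ratio eps by rewrite /grid_ratio; nra.
have r0 : 0 < grid_ratio eps by lra.
rewrite /grid_pt mulrC -ler_pdivrMr// -ler_ln ?posrE ?divr_gt0 ?exprn_gt0//.
rewrite lnXn// -mulr_natl -ler_pdivrMr ?ln_gt0//.
by rewrite (le_trans (ceil_ge _))// natr_absz ler_int ler_norm.
Qed.

Lemma lineE (R : realType) (U : nat) (eps : R) (f : R -> R) (p : nat) (x : R) :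
  intercept U eps f p + slope U eps f p * x =
  f (grid_pt U eps p) + deriv_or_right f (grid_pt U eps p)
                        * (x - grid_pt U eps p).
Proof. by rewrite /intercept /slope; ring. Qed.

Lemma le_line (R : realType) (U : nat) (eps : R) (f : R -> R) (p : nat) (x : R) :
  concave_function `[0, +oo[%classic f -> (1 < U)%N -> 0 < eps -> 0 <= x ->
  f x <= intercept U eps f p + slope U eps f p * x.
Proof.
move=> fc U1 e0 x0; rewrite lineE; apply: le_tangent => //.
exact: grid_pt_gt0.
Qed.

Lemma pwl_le_line (R : realType) (U : nat) (eps : R) (f : R -> R) (p : nat)
    (x : R) :
  concave_function `[0, +oo[%classic f -> (1 < U)%N -> 0 < eps ->
  (p <= grid_num U eps)%N ->
  pwl U eps f x <= intercept U eps f p + slope U eps f p * x.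
Proof.
move=> fc U1 e0 pP; rewrite /pwl; case: eqP => [->|_]; first exact: le_line.
by rewrite (@ge_bigmin_seq _ _ _ _ _ p predT)// mem_index_iota.
Qed.

Lemma le_pwl_lines (R : realType) (U : nat) (eps : R) (f : R -> R) (x z : R) :
  x != 0 ->
  (forall p, (p <= grid_num U eps)%N ->
     z <= intercept U eps f p + slope U eps f p * x) ->
  z <= pwl U eps f x.
Proof.
move=> /negPf x0 zl; rewrite /pwl x0 big_seq.
apply: le_bigmin => [|p]; first exact: zl.
by rewrite mem_index_iota; exact: zl.
Qed.

Lemma le_pwl (R : realType) (U : nat) (eps : R) (f : R -> R) (x : R) :
  concave_function `[0, +oo[%classic f -> (1 < U)%N -> 0 < eps -> 0 <= x ->
  f x <= pwl U eps f x.
Proof.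
move=> fc U1 e0 x0; have [->|xN0] := eqVneq x 0; first by rewrite /pwl eqxx.
by apply: le_pwl_lines => // p _; exact: le_line.
Qed.

(** A minimum of lines is concave. Lowering its value at 0 to [f 0] preserves this, since 0 is an
    endpoint of the half-line. *)
Lemma pwl_concave (R : realType) (U : nat) (eps : R) (f : R -> R) :
  concave_function `[0, +oo[%classic f -> (1 < U)%N -> 0 < eps ->
  concave_function `[0, +oo[%classic (pwl U eps f).
Proof.
move=> fc U1 e0; apply/concave_functionP => x y t x0 y0 t0 t1.
(* A combination equal to 0 has both terms 0, so each point with nonzero weight is itself 0. *)
have [z0|zN0] := eqVneq (t * x + (1 - t) * y) 0.
  rewrite z0.
  have /eqP tx0 : t * x == 0.
    by rewrite eq_le mulr_ge0// andbT -z0 lerDl mulr_ge0// subr_ge0.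
  have /eqP ty0 : (1 - t) * y == 0 by rewrite -z0 tx0 add0r.
  have absorb (u v : R) : u * v = 0 -> u * pwl U eps f v = u * pwl U eps f 0.
    by move=> /eqP; rewrite mulf_eq0 => /orP[|] /eqP ->; rewrite ?mul0r.
  by rewrite !absorb// -mulrDl subrKC mul1r.
apply: le_pwl_lines => // p pP.
have := ler_wpM2l t0 (pwl_le_line x fc U1 e0 pP).
have := @ler_wpM2l _ (1 - t) _ _ _ (pwl_le_line y fc U1 e0 pP).
by rewrite subr_ge0 => /(_ t1); lra.
Qed.

Lemma pwl_nondecreasing (R : realType) (U : nat) (eps : R) (f : R -> R) :
  concave_function `[0, +oo[%classic f ->
  {in `[0, +oo[ &, nondecreasing_fun f} -> (1 < U)%N -> 0 < eps ->
  {in `[0, +oo[ &, nondecreasing_fun (pwl U eps f)}.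
Proof.
move=> fc fi U1 e0 x y; rewrite !in_itv /= !andbT => x0 y0 xy.
have [y00|yN0] := eqVneq y 0.
  by have -> : x = y by apply/eqP; rewrite eq_le xy y00 x0.
apply: le_pwl_lines => // p pP; apply: (le_trans (pwl_le_line x fc U1 e0 pP)).
rewrite lerD2l ler_wpM2l// deriv_or_right_ge0//; exact: grid_pt_gt0.
Qed.

Lemma pwl_le (R : realType) (U : nat) (eps : R) (f : R -> R) (x : R) :
  concave_function `[0, +oo[%classic f ->
  {in `[0, +oo[ &, nondecreasing_fun f} -> 0 <= f 0 -> (1 < U)%N -> 0 < eps ->
  grid_lo R U <= x -> x <= grid_hi R U -> pwl U eps f x <= (1 + eps) * f x.
Proof.
move=> fc fi f0 U1 e0 lox xhi.
have hi1 := grid_hi_ge1 R U1.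
have lo0 : 0 < grid_lo R U by rewrite invr_gt0; exact: lt_le_trans ltr01 hi1.
have x0 : 0 <= x by lra.
have xP := le_trans xhi (grid_hi_le U1 e0).
(* Locates [x] between consecutive grid points; the equality covers [P = 0], where there is no
   interval yet. *)
have bracket P : x <= grid_pt U eps P -> x = grid_pt U eps 0 \/
    exists2 p, (p < P)%N & grid_pt U eps p <= x <= grid_pt U eps p.+1.
  elim: P => [|P IH] xle.
    left; apply/eqP; rewrite eq_le xle.
    by rewrite /grid_pt expr0 mulr1.
  have [/IH[|[p pP ?]]|Px] := leP x (grid_pt U eps P); first by left.
    by right; exists p => //; exact: ltnW.
  by right; exists P; rewrite ?(ltW Px).
have [xE|[p pP /andP[px xp]]] := bracket _ xP.
  apply: (le_trans (pwl_le_line x fc U1 e0 (leq0n _))).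
  rewrite lineE -xE subrr mulr0 addr0.
  apply: ler_peMl; last by rewrite lerDl ltW.
  by apply: (le_trans f0); apply: fi; rewrite ?in_itv /= ?lexx ?x0.
have := @min_tangent_le R f (grid_pt U eps p) (grid_pt U eps p.+1)
  (1 + 2 * eps) x fc fi f0 (grid_pt_gt0 p U1 e0) _ _ px xp.
have -> : (1 + (1 + 2 * eps)) / 2 = 1 + eps by field.
rewrite -!lineE => h; apply: (le_trans _ (h _ _)).
- by rewrite le_min !pwl_le_line// ltnW.
- by lra.
- by rewrite -grid_ratioE /grid_pt exprSr mulrA.
Qed.

(** * Polyhedra: active constraints and basic solutions *)

(* The constraints [A x <= b] and [0 <= x], indexed by the rows of [A] and by
   the coordinates of [x], in the uniform format [0 <= slack A b x k]. *)
Definition slack (R : realFieldType) (m n : nat) (A : 'M[R]_(m, n))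
    (b : 'cV[R]_m) (x : 'cV[R]_n) (k : 'I_m + 'I_n) : R :=
  match k with inl i => b i 0 - (A *m x) i 0 | inr j => x j 0 end.

Definition active (R : realFieldType) (m n : nat) (A : 'M[R]_(m, n))
    (b : 'cV[R]_m) (x : 'cV[R]_n) : {set 'I_m + 'I_n} :=
  [set k | slack A b x k == 0]%SET.

Definition feasible (R : realFieldType) (m n : nat) (A : 'M[R]_(m, n))
    (b : 'cV[R]_m) (x : 'cV[R]_n) : Prop := forall k, 0 <= slack A b x k.

(** [active A 0 d] holds the constraints whose slack is constant along [d]. Thus no line through [x]
    stays inside all active constraints, which describes a vertex without mentioning rank. *)
Definition basic_solution (R : realFieldType) (m n : nat) (A : 'M[R]_(m, n))
    (b : 'cV[R]_m) (x : 'cV[R]_n) : Prop :=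
  feasible A b x /\ forall d, active A b x \subset active A 0 d -> d = 0.

Lemma slackD (R : realFieldType) (m n : nat) (A : 'M[R]_(m, n))
    (b : 'cV[R]_m) (x d : 'cV[R]_n) (t : R) (k : 'I_m + 'I_n) :
  slack A b (x + t *: d) k = slack A b x k + t * slack A 0 d k.
Proof.
by case: k => [i|j] /=; rewrite ?mulmxDr -?scalemxAr !mxE; ring.
Qed.

Lemma polyhedronE (R : realType) (m n : nat) (A : 'M[rat]_(m, n))
    (b : 'cV[rat]_m) (x : 'cV[R]_n) :
  polyhedron R A b x <-> feasible (map_mx ratr A) (map_mx ratr b) x.
Proof.
split=> [[Axb x0] [i|j]|xf]; [|exact: x0|split=> [i|j]; [|exact: (xf (inr j))]].
  by rewrite /= subr_ge0 [X in _ <= X]mxE.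
by have := xf (inl i); rewrite /= subr_ge0 [X in _ <= X]mxE.
Qed.

(** The ratio test of the simplex method: the step is the least quotient of slack by rate of
    decrease, and a constraint attaining it becomes active. The negative coordinate of [d] ensures
    that some slack decreases. *)
Lemma move_to_facet (R : realFieldType) (m n : nat) (A : 'M[R]_(m, n))
    (b : 'cV[R]_m) (x d : 'cV[R]_n) :
  feasible A b x -> active A b x \subset active A 0 d ->
  (exists j, d j 0 < 0) ->
  exists t, [/\ 0 < t, feasible A b (x + t *: d)
    & active A b x \proper active A b (x + t *: d)].
Proof.
move=> xf xd [j dj].
have Pj : slack A 0 d (inr j) < 0 by [].
pose ratio k := slack A b x k / - slack A 0 d k.
case: (arg_minP (P := fun k => slack A 0 d k < 0) ratio Pj) => k dk kmin.
(* Active constraints have rate 0 along [d], so decreasing ones have positive slack and the step is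
   positive. *)
have inactive l : slack A 0 d l < 0 -> slack A b x l != 0.
  move=> dl; apply/negP => xl0; have /(fintype.subsetP xd) : l \in active A b x.
    by rewrite inE.
  by rewrite inE => /eqP d0; rewrite d0 ltxx in dl.
exists (ratio k); split=> [|l|].
- by rewrite divr_gt0 ?oppr_gt0// lt_neqAle eq_sym inactive//= xf.
- rewrite slackD; have [dl|dl] := ltP (slack A 0 d l) 0.
    by have := kmin l dl; rewrite {2}/ratio ler_pdivlMr ?oppr_gt0//; lra.
  rewrite addr_ge0 ?xf// mulr_ge0// divr_ge0 ?xf//.
  by rewrite oppr_ge0 ltW.
- apply/properP; split.
    apply/fintype.subsetP => l xl; have := fintype.subsetP xd l xl; move: xl.
    by rewrite !inE slackD => /eqP -> /eqP ->; rewrite mulr0 addr0.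
  exists k; rewrite !inE; last exact: inactive.
  by rewrite slackD /ratio; apply/eqP; field; rewrite lt_eqF.
Qed.

(** The direction [y - x] keeps the common active constraints active, so it vanishes. Hence there
    are only finitely many basic solutions. *)
Lemma basic_solution_inj (R : realFieldType) (m n : nat) (A : 'M[R]_(m, n))
    (b : 'cV[R]_m) (x y : 'cV[R]_n) :
  basic_solution A b x -> basic_solution A b y ->
  active A b x = active A b y -> x = y.
Proof.
move=> [_ xb] _ xy; apply/esym/eqP; rewrite -subr_eq0; apply/eqP/xb.
apply/fintype.subsetP => k kx; have := kx; rewrite xy; move: kx.
have yE : y = x + 1 *: (y - x) by rewrite scale1r addrC subrK.
by rewrite !inE {1}yE slackD => /eqP ->; rewrite add0r mul1r.
Qed.

(** * Separable concave minimization at basic solutions *)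

Lemma separable_nondecreasing (R : realType) (n : nat) (f : 'I_n -> R -> R)
    (x y : 'cV[R]_n) :
  (forall i, {in `[0, +oo[ &, nondecreasing_fun (f i)}) ->
  (forall i, 0 <= x i 0 <= y i 0) -> separable f x <= separable f y.
Proof.
move=> fi xy; apply: ler_sum => i _; have /andP[x0 xyi] := xy i.
by apply: fi; rewrite ?in_itv /= ?andbT ?x0// (le_trans x0).
Qed.

Lemma separable_concave (R : realType) (n : nat) (f : 'I_n -> R -> R)
    (x y : 'cV[R]_n) (t : R) :
  (forall i, concave_function `[0, +oo[%classic (f i)) ->
  (forall i, 0 <= x i 0) -> (forall i, 0 <= y i 0) -> 0 <= t -> t <= 1 ->
  t * separable f x + (1 - t) * separable f y <=
  separable f (t *: x + (1 - t) *: y).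
Proof.
move=> fc x0 y0 t0 t1; rewrite !mulr_sumr -big_split /=.
apply: ler_sum => i _; rewrite !mxE.
exact: (concave_functionP _).1.
Qed.

Lemma exists_basic_solution_le (R : realType) (m n : nat) (A : 'M[R]_(m, n))
    (b : 'cV[R]_m) (f : 'I_n -> R -> R) (x : 'cV[R]_n) :
  (forall i, {in `[0, +oo[ &, nondecreasing_fun (f i)}) ->
  (forall i, concave_function `[0, +oo[%classic (f i)) ->
  feasible A b x ->
  exists2 v, basic_solution A b v & separable f v <= separable f x.
Proof.
(* Induction on the number of inactive constraints, which each move to a facet decreases. *)
move=> fi fc; have [N] := ubnP #|~: active A b x|.
elim: N x => // N IH x; rewrite ltnS => leN xf.
have IHx y : feasible A b y -> active A b x \proper active A b y ->
    separable f y <= separable f x ->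
    exists2 v, basic_solution A b v & separable f v <= separable f x.
  move=> yf xy fyx; have [||v vb vy] := IH y => //.
    by rewrite (leq_trans _ leN)// proper_card// properC.
  by exists v => //; exact: le_trans vy fyx.
have [xb|] := pselect (basic_solution A b x); first by exists x.
move=> /not_andP[//|/existsNP[d /not_implyP[xd d0]]].
have xdN : active A b x \subset active A 0 (- d).
  apply/fintype.subsetP => k /(fintype.subsetP xd); rewrite !inE => /eqP dk.
  have -> : - d = 0 + (-1) *: d by rewrite add0r scaleN1r.
  rewrite slackD dk mulr0 addr0.
  by case: k {dk} => [i|j] /=; rewrite ?mulmx0 !mxE ?subr0.
(* Along a direction without positive coordinates, monotonicity alone makes the move harmless. *)
have down e : active A b x \subset active A 0 e -> e != 0 ->
    (forall j, e j 0 <= 0) ->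
    exists2 v, basic_solution A b v & separable f v <= separable f x.
  move=> xe eN0 e0.
  have [|t [t0 yf xy]] := move_to_facet xf xe.
    move: eN0 => /cV0Pn[j ej]; exists j.
    by rewrite lt_neqAle ej e0.
  apply: (IHx _ yf xy); apply: separable_nondecreasing => // j.
  have := yf (inr j) => /= ->; rewrite !mxE gerDl.
  by rewrite mulr_ge0_le0// ltW.
have [dneg|/forallNP dge] := pselect (exists j, d j 0 < 0); last first.
  apply: (down (- d)) => // [|j]; first by rewrite oppr_eq0; exact/eqP.
  by rewrite mxE oppr_le0 leNgt; exact/negP/dge.
have [dpos|/forallNP dle] := pselect (exists j, (- d) j 0 < 0); last first.
  apply: (down d) => // [|j]; first exact/eqP.
  by have /negP := dle j; rewrite -leNgt mxE oppr_ge0.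
have [t [t0 yf xy]] := move_to_facet xf xd dneg.
have [s [s0 zf xz]] := move_to_facet xf xdN dpos.
set y := x + t *: d in yf xy; set z := x + s *: - d in zf xz.
have [fyx|fyx] := leP (separable f y) (separable f x); first exact: IHx yf xy _.
have [fzx|fzx] := leP (separable f z) (separable f x); first exact: IHx zf xz _.
(* With [y = x + t *: d] and [z = x - s *: d], the weight [s / (s + t)] on [y] recovers [x]. Were
   both ends strictly worse than [x], concavity would fail. *)
have := @separable_concave R n f y z (s / (s + t)) fc
  (fun i => yf (inr i)) (fun i => zf (inr i)).
have -> : s / (s + t) *: y + (1 - s / (s + t)) *: z = x.
  have stN0 : s + t != 0 by rewrite gt_eqF// addr_gt0.
  by apply/matrixP => i j; rewrite !mxE; field.
have p0 : 0 < s / (s + t) by rewrite divr_gt0// addr_gt0.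
have p1 : s / (s + t) < 1 by rewrite ltr_pdivrMr ?addr_gt0//; lra.
move=> /(_ (ltW p0) (ltW p1)).
have : s / (s + t) * separable f x < s / (s + t) * separable f y.
  by rewrite ltr_pM2l.
have : (1 - s / (s + t)) * separable f x < (1 - s / (s + t)) * separable f z.
  by rewrite ltr_pM2l// subr_gt0.
by lra.
Qed.

(** The minimum is taken over the finitely many active sets. Compactness and continuity would not
    do: the polyhedron may be unbounded and the components may jump at 0. *)
Lemma exists_basic_solution_min (R : realType) (m n : nat) (A : 'M[R]_(m, n))
    (b : 'cV[R]_m) (f : 'I_n -> R -> R) :
  (forall i, {in `[0, +oo[ &, nondecreasing_fun (f i)}) ->
  (forall i, concave_function `[0, +oo[%classic (f i)) ->
  (exists x, feasible A b x) ->
  exists2 v, basic_solution A b v &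
    forall x, feasible A b x -> separable f v <= separable f x.
Proof.
move=> fi fc [x xf].
pose B S := [set v | basic_solution A b v /\ active A b v = S].
have [v0 v0b _] := exists_basic_solution_le fi fc xf.
(* The basic solution chosen for an active set is the only one with that set. *)
have Bget v : basic_solution A b v -> xget 0 (B (active A b v)) = v.
  move=> vb; case: xgetP => [w -> [wb /basic_solution_inj]|/(_ v)[]//].
  by apply.
have P0 : `[< exists v, B (active A b v0) v >] by apply/asboolP; exists v0.
case: (arg_minP (P := fun S => `[< exists v, B S v >])
  (fun S => separable f (xget 0 (B S))) P0) => S /asboolP[v [vb <-]].
rewrite Bget// => vmin; exists v => // y yf.
have [w wb wy] := exists_basic_solution_le fi fc yf.
apply: le_trans wy; have := vmin (active A b w); rewrite Bget//; apply.
by apply/asboolP; exists w.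
Qed.

(** * Determinant bounds, Cramer's rule and nonsingular subsystems *)

Lemma sum_comp_inj_le (R : numDomainType) (I J : finType) (h : I -> J)
    (F : J -> R) :
  injective h -> (forall j, 0 <= F j) -> \sum_i F (h i) <= \sum_j F j.
Proof.
move=> h_inj F0; rewrite [leRHS](bigID (mem [set h i | i in I]%SET)) /=.
rewrite big_imset /=; last by move=> i j _ _; exact: h_inj.
by rewrite lerDl sumr_ge0.
Qed.

Lemma sum_comp_inj_leq (I J : finType) (h : I -> J) (F : J -> nat) :
  injective h -> (\sum_i F (h i) <= \sum_j F j)%N.
Proof.
move=> h_inj; rewrite [leqRHS](bigID (mem [set h i | i in I]%SET)) /=.
rewrite big_imset /=; last by move=> i j _ _; exact: h_inj.
by rewrite leq_addr.
Qed.

(** The remaining terms of the expanded product are nonnegative. This turns row sums into products,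
    which match sums of sizes in the exponent. *)
Lemma sum_le_prod1D (R : numDomainType) (I : Type) (r : seq I) (F : I -> R) :
  (forall i, 0 <= F i) -> 1 + \sum_(i <- r) F i <= \prod_(i <- r) (1 + F i).
Proof.
move=> F0; elim: r => [|i r IH]; first by rewrite !big_nil addr0.
rewrite !big_cons; set S := \sum_(j <- r) F j in IH *.
have S0 : 0 <= S by exact: sumr_ge0.
apply: (@le_trans _ _ ((1 + F i) * (1 + S))).
  have -> : (1 + F i) * (1 + S) = 1 + (F i + S) + F i * S by ring.
  by rewrite lerDl mulr_ge0.
by rewrite ler_wpM2l// addr_ge0.
Qed.

(** Laplace expansion along the first row; deleting a column only shrinks the other row sums. *)
Lemma norm_det_le (R : numDomainType) (k : nat) (D : 'M[R]_k) :
  `|\det D| <= \prod_i \sum_j `|D i j|.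
Proof.
elim: k D => [|k IH] D; first by rewrite det_mx00 big_ord0 normr1.
rewrite (expand_det_row D ord0) [leRHS]big_ord_recl mulr_suml.
apply: (le_trans (ler_norm_sum _ _ _)); apply: ler_sum => j _.
rewrite normrM ler_wpM2l// /cofactor normrM normrX normrN1 expr1n mul1r.
apply: (le_trans (IH _)); apply: ler_prod => i _.
rewrite sumr_ge0//=; under eq_bigr do rewrite !mxE.
by apply: (sum_comp_inj_le (F := fun j => `|D _ j|)); [exact: lift_inj|].
Qed.

Lemma det_int (R : archiNumDomainType) (k : nat) (D : 'M[R]_k) :
  (forall i j, D i j \is a Num.int) -> \det D \is a Num.int.
Proof.
move=> Dint; apply: rpred_sum => s _; rewrite rpredM ?rpredX ?rpredN ?rpred1//.
by apply: rpred_prod.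
Qed.

(** The coordinate is a quotient of two nonzero integer determinants, each of absolute value at
    least 1. Adding [c] to the row sums lets [T] bound both. *)
Lemma cramer_int_bound (R : archiRealFieldType) (k : nat) (D : 'M[R]_k)
    (c y : 'cV[R]_k) (j : 'I_k) :
  (forall i l, D i l \is a Num.int) -> (forall i, c i 0 \is a Num.int) ->
  D \in unitmx -> D *m y = c -> y j 0 != 0 ->
  let T := \prod_i (`|c i 0| + \sum_l `|D i l|) in
  T^-1 <= `|y j 0| /\ `|y j 0| <= T.
Proof.
move=> Dint cint Du Dy yj T.
pose C := \matrix_(i, l) if l == j then c i 0 else D i l.
have detC : \det C = \det D * y j 0.
  have : \adj D *m c = \det D *: y.
    by rewrite -Dy mulmxA mul_adj_mx mul_scalar_mx.
  move=> /matrixP/(_ j 0); rewrite !mxE => <-.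
  rewrite (expand_det_col C j); apply: eq_bigr => i _.
  rewrite !mxE eqxx mulrC; congr (_ * _); rewrite /cofactor; congr (_ * \det _).
  by apply/matrixP => p q; rewrite !mxE eq_sym (negPf (neq_lift _ _)).
have Cint i l : C i l \is a Num.int by rewrite mxE; case: ifP.
have detD0 : \det D != 0 by rewrite -unitfE.
have detCT : `|\det C| <= T.
  apply: (le_trans (norm_det_le _)); apply: ler_prod => i _.
  rewrite sumr_ge0//= (bigD1 j)//= mxE eqxx lerD2l [leRHS](bigD1 j)//=.
  rewrite (eq_bigr (fun l => `|D i l|)) ?lerDr// => l /negPf lj.
  by rewrite mxE lj.
have detDT : `|\det D| <= T.
  apply: (le_trans (norm_det_le _)); apply: ler_prod => i _.
  by rewrite sumr_ge0//= lerDr.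
have detD1 : 1 <= `|\det D| by rewrite norm_intr_ge1// det_int.
have detC1 : 1 <= `|\det C|.
  by rewrite norm_intr_ge1 ?det_int// detC mulf_neq0.
have D0 : 0 < `|\det D| by rewrite normr_gt0.
have T0 : 0 < T by exact: lt_le_trans D0 detDT.
have -> : `|y j 0| = `|\det C| / `|\det D|.
  by rewrite detC normrM mulrAC mulfV ?mul1r// normr_eq0.
split.
  rewrite ler_pdivlMr// mulrC ler_pdivrMr// (le_trans detDT)//.
  by rewrite ler_peMl// ltW.
by rewrite ler_pdivrMr// (le_trans detCT)// ler_peMr// ltW.
Qed.

(** Keep the active rows of [A] and the columns where [x] is nonzero. Basicness gives this submatrix
    full column rank, so a square invertible set of rows can be selected. *)
Lemma basic_solution_system (R : realFieldType) (m n : nat) (A : 'M[R]_(m, n))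
    (b : 'cV[R]_m) (x : 'cV[R]_n) :
  basic_solution A b x ->
  exists k (g : 'I_k -> 'I_m) (h : 'I_k -> 'I_n),
    [/\ injective g, injective h, forall j, x j 0 != 0 -> exists l, j = h l,
        mxsub g h A \in unitmx & mxsub g h A *m rowsub h x = rowsub g b].
Proof.
move=> [xf xb].
pose I := [set i | inl i \in active A b x]%SET.
pose J := [set j | x j 0 != 0]%SET.
pose g0 : 'I_#|I| -> 'I_m := enum_val.
pose h : 'I_#|J| -> 'I_n := enum_val.
have h_inj : injective h by exact: enum_val_inj.
(* [E] pads a vector indexed by the support of [x] with zeros. *)
pose E : 'M[R]_(n, #|J|) := colsub h 1%:M.
have hE : rowsub h E = 1%:M.
  by apply/matrixP => i j; rewrite !mxE (inj_eq h_inj).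
have hJ j : x j 0 != 0 -> exists l, j = h l.
  move=> xj; have jJ : j \in J by rewrite inE.
  by exists (enum_rank_in jJ j); rewrite /h enum_rankK_in.
have outE (w : 'cV[R]_#|J|) j : x j 0 = 0 -> (E *m w) j 0 = 0.
  move=> xj; rewrite mxE big1// => l _; rewrite !mxE.
  case: eqP => [jl|_]; last by rewrite mul0r.
  by have := enum_valP l; rewrite -/(h l) -jl inE xj eqxx.
have xE : x = E *m rowsub h x.
  apply/matrixP => j l; rewrite ord1; have [xj|/hJ[i ->]] := eqVneq (x j 0) 0.
    by rewrite outE.
  have /(congr1 (fun v : 'cV_#|J| => v i 0)) := mul_rowsub_mx h E (rowsub h x).
  by rewrite hE mul1mx !mxE.
have AE (w : 'cV[R]_#|J|) i :
    (mxsub g0 h A *m w) i 0 = (A *m (E *m w)) (g0 i) 0.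
  by rewrite mulmxA mulmx_colsub mulmx1 mxsubrc mul_rowsub_mx [LHS]mxE.
(* A kernel vector, padded with zeros, is a direction keeping every active constraint active, hence
   zero. *)
have Afull : row_full (mxsub g0 h A).
  rewrite -[row_full _]/(_ == _) -mxrank_tr; apply: inj_row_free => v.
  move=> /(congr1 trmx); rewrite trmx_mul trmxK trmx0 => Bv0.
  apply: trmx_inj; rewrite trmx0 -[LHS]mul1mx -hE mul_rowsub_mx.
  suff -> : E *m v^T = 0 by apply/matrixP => i l; rewrite !mxE.
  apply: xb.
  apply/fintype.subsetP => -[i|j]; rewrite inE => xk; rewrite inE; last first.
    by apply/eqP/outE/eqP.
  have iI : i \in I by rewrite !inE.
  have := AE v^T (enum_rank_in iI i).
  by rewrite Bv0 /g0 enum_rankK_in// /= => <-; rewrite !mxE subr0.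
exists #|J|, (g0 \o fullrankfun Afull), h; split=> //.
- by apply: inj_comp; [exact: enum_val_inj|exact: fullrankfun_inj].
- by have := fullrowsub_unit Afull; rewrite -mxsub_comp; congr (_ \in _).
apply/matrixP => i l; rewrite ord1.
have := AE (rowsub h x) (fullrankfun Afull i); rewrite -xE.
have := enum_valP (fullrankfun Afull i); rewrite !inE /= subr_eq0 => /eqP.
rewrite -/(g0 _) => <- H.
rewrite [RHS]mxE -H !mxE; apply: eq_bigr => p _.
by rewrite !mxE.
Qed.

(** * Encoding sizes, clearing of denominators and coordinate bounds *)

Lemma int_size_ge (R : numDomainType) (z : int) :
  1 + `|z%:~R| <= 2 ^+ int_size z :> R.
Proof.
rewrite -intr_norm -natr_absz -natrX -[1]/(1%:R) -natrD ler_nat.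
rewrite addnC (leq_trans (up_logP (`|z| + 1) (isT : (1 < 2)%N)))//.
by rewrite leq_exp2l// leq_addl.
Qed.

Lemma intr_denq_gt0 (R : realFieldType) (r : rat) : 0 < (denq r)%:~R :> R.
Proof. by rewrite ltr0z. Qed.

Lemma rat_size_ge (R : realFieldType) (r : rat) :
  (denq r)%:~R * (1 + `|(numq r)%:~R|) <= 2 ^+ rat_size r :> R.
Proof.
rewrite /rat_size addnC exprD.
rewrite ler_pM ?int_size_ge ?addr_ge0 ?(ltW (intr_denq_gt0 _ _))//.
apply: le_trans (int_size_ge _ _); rewrite ler_wpDl//.
exact: ler_norm.
Qed.

Lemma ratr_denq (R : realFieldType) (r : rat) :
  (denq r)%:~R * ratr r = (numq r)%:~R :> R.
Proof. by rewrite /ratr mulrC divfK// gt_eqF// intr_denq_gt0. Qed.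

Lemma norm_ratr_le (R : realFieldType) (r : rat) :
  `|ratr r| <= `|(numq r)%:~R| :> R.
Proof.
rewrite -ratr_denq [leRHS]normrM ler_peMl// -intr_norm -[1]/(1%:~R) ler_int.
have := denq_gt0 r; rewrite gtz0_ge1 => d1.
by rewrite ger0_norm ?(le_trans _ d1).
Qed.

(** A product rather than a least common multiple, so that each denominator can be charged to the
    size of its own entry. *)
Definition row_denominator (R : realFieldType) (m n : nat) (A : 'M[rat]_(m, n))
    (b : 'cV[rat]_m) (i : 'I_m) : R :=
  (denq (b i 0))%:~R * \prod_j (denq (A i j))%:~R.

Lemma row_denominator_gt0 (R : realFieldType) (m n : nat)
    (A : 'M[rat]_(m, n)) (b : 'cV[rat]_m) (i : 'I_m) :
  0 < row_denominator R A b i.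
Proof.
by rewrite mulr_gt0 ?intr_denq_gt0// prodr_gt0// => j _; exact: intr_denq_gt0.
Qed.

Lemma row_denominator_rhs_int (R : archiRealFieldType) (m n : nat)
    (A : 'M[rat]_(m, n)) (b : 'cV[rat]_m) (i : 'I_m) :
  row_denominator R A b i * ratr (b i 0) \is a Num.int.
Proof.
rewrite mulrAC ratr_denq rpredM ?intr_int// rpred_prod// => j _.
exact: intr_int.
Qed.

Lemma row_denominator_mx_int (R : archiRealFieldType) (m n : nat)
    (A : 'M[rat]_(m, n)) (b : 'cV[rat]_m) (i : 'I_m) (j : 'I_n) :
  row_denominator R A b i * ratr (A i j) \is a Num.int.
Proof.
rewrite -mulrA (bigD1 j)//= mulrAC ratr_denq !rpredM ?intr_int//.
by rewrite rpred_prod// => l _; exact: intr_int.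
Qed.

(** Bound the row sum by a product of factors [1 + N r], then pair each with the denominator of the
    same entry by [rat_size_ge]. *)
Lemma row_denominator_le (R : realFieldType) (m n : nat)
    (A : 'M[rat]_(m, n)) (b : 'cV[rat]_m) (i : 'I_m) :
  row_denominator R A b i * (`|ratr (b i 0)| + \sum_j `|ratr (A i j)|) <=
  2 ^+ (rat_size (b i 0) + \sum_j rat_size (A i j)).
Proof.
pose N r : R := `|(numq r)%:~R|.
have N0 r : 0 <= N r by exact: normr_ge0.
apply: (@le_trans _ _ (row_denominator R A b i *
    ((1 + N (b i 0)) * \prod_j (1 + N (A i j))))).
  rewrite ler_wpM2l ?(ltW (row_denominator_gt0 _ _ _ _))//.
  apply: (@le_trans _ _ ((1 + N (b i 0)) * (1 + \sum_j N (A i j)))).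
    have s0 : 0 <= \sum_j N (A i j) by exact: sumr_ge0.
    have := N0 (b i 0).
    have h1 : `|ratr (b i 0)| <= N (b i 0) by exact: norm_ratr_le.
    have h2 : \sum_j `|ratr (A i j)| <= \sum_j N (A i j).
      by apply: ler_sum => j _; exact: norm_ratr_le.
    by nra.
  by rewrite ler_wpM2l ?addr_ge0// sum_le_prod1D.
rewrite mulrACA -big_split exprD expr_sum /=.
have den0 r : 0 <= (denq r)%:~R * (1 + N r).
  by rewrite mulr_ge0 ?addr_ge0// ltW// intr_denq_gt0.
apply: ler_pM; rewrite ?den0 ?rat_size_ge ?prodr_ge0//.
by apply: ler_prod => j _; rewrite den0 rat_size_ge.
Qed.

Lemma exprn2D1_le (R : realFieldType) (N : nat) :
  2 ^+ N + 1 <= 2 ^+ N.+1 :> R.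
Proof.
have : 1 <= (2 : R) ^+ N by rewrite exprn_ege1// ler1n.
by rewrite exprS; lra.
Qed.

Lemma basic_solution_bound (R : realType) (m n : nat) (A : 'M[rat]_(m, n))
    (b : 'cV[rat]_m) (x : 'cV[R]_n) (j : 'I_n) :
  basic_solution (map_mx ratr A) (map_mx ratr b) x -> x j 0 != 0 ->
  grid_lo R (size_bound A b) <= x j 0 /\ x j 0 <= grid_hi R (size_bound A b).
Proof.
move=> xb xj; have xj0 : 0 <= x j 0 by exact: (xb.1 (inr j)).
have [k [g [h [g_inj h_inj supp Mu Mx]]]] := basic_solution_system xb.
have [l jE] := supp j xj.
pose den p := row_denominator R A b (g p).
have den0 p : 0 < den p by exact: row_denominator_gt0.
(* Scaling the rows by [S] makes the subsystem integral without changing its solution. *)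
pose S : 'M[R]_k := diag_mx (\row_p den p).
set M := mxsub g h _ in Mu Mx; set c := rowsub g _ in Mx.
have SE (q : nat) (B : 'M[R]_(k, q)) p r : (S *m B) p r = den p * B p r.
  by rewrite /S mul_diag_mx !mxE.
have Du : S *m M \in unitmx.
  rewrite unitmx_mul Mu andbT unitmxE det_diag unitfE prodf_seq_neq0.
  by apply/allP => p _; rewrite mxE /= gt_eqF.
have [] := @cramer_int_bound R k (S *m M) (S *m c) (rowsub h x) l.
- by move=> p q; rewrite SE !mxE; exact: row_denominator_mx_int.
- by move=> p; rewrite SE !mxE; exact: row_denominator_rhs_int.
- exact: Du.
- by rewrite -mulmxA Mx.
- by rewrite mxE -jE.
rewrite mxE -jE ger0_norm//; set T := \prod_p _.
have T_le : T <= 2 ^+ (mx_size A + mx_size b).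
  pose w i := (rat_size (b i 0%R) + \sum_j rat_size (A i j))%N.
  apply: (@le_trans _ _ (\prod_p 2 ^+ w (g p))).
    apply: ler_prod => p _; rewrite addr_ge0 ?sumr_ge0//=.
    apply: le_trans (row_denominator_le R A b (g p)).
    rewrite SE normrM gtr0_norm// !mxE mulrDr lerD2l.
    under eq_bigr do rewrite SE normrM gtr0_norm// !mxE.
    rewrite -mulr_sumr ler_wpM2l ?(ltW (den0 _))//.
    exact: (sum_comp_inj_le (F := fun j => `|ratr (A (g p) j)|)).
  rewrite -expr_sum ler_eXn2l ?ltr1n//.
  (* As [g] selects distinct rows, the size of each row is counted at most once. *)
  apply: (leq_trans (sum_comp_inj_leq _ g_inj)); rewrite big_split /= addnC.
  rewrite /mx_size leq_add ?leq_addl//.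
  apply: leq_trans (leq_addl _ _); apply: leq_sum => i _.
  by rewrite big_ord1.
have T_hi : T <= grid_hi R (size_bound A b).
  apply: (le_trans T_le); rewrite /grid_hi lerBrDr.
  have n_gt0 : (0 < n)%N by exact: leq_ltn_trans (leq0n j) (ltn_ord j).
  (* One extra power of 2 absorbs the [- 1] in [grid_hi]; [0 < n] makes room for it in the
     exponent. *)
  apply: (le_trans (exprn2D1_le _ _)).
  by rewrite ler_eXn2l ?ltr1n// /size_bound; lia.
move=> lo hi; split; last exact: le_trans hi T_hi.
have T_gt0 : 0 < T by apply: lt_le_trans hi; rewrite lt_neqAle eq_sym xj.
by apply: le_trans lo; rewrite lef_pV2 ?posrE// (lt_le_trans T_gt0).
Qed.

Theorem lemma6 (R : realType) (m n : nat) (eps : R)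
    (A : 'M[rat]_(m, n)) (b : 'cV[rat]_m) (phi : 'I_n -> R -> R)
    (eps_gt0 : 0 < eps)
    (X_neq0 : polyhedron R A b !=set0)
    (phi_ge0 : forall (i : 'I_n) (x : R), 0 <= x -> 0 <= phi i x)
    (phi_nondecreasing :
      forall i : 'I_n, {in `[0, +oo[ &, nondecreasing_fun (phi i)})
    (phi_concave : forall i : 'I_n, concave_function `[0, +oo[ (phi i)) :
  let psi := fun i : 'I_n => pwl (size_bound A b) eps (phi i) in
  exists Zconc Zpwl : R,
    [/\ is_minimum (separable phi @` polyhedron R A b) Zconc,
        is_minimum (separable psi @` polyhedron R A b) Zpwl,
        Zconc <= Zpwl
      & Zpwl <= (1 + eps) * Zconc].
Proof.
move=> psi.
(* The index [i] forces [0 < n]; for [n = 0] the size bound can be 0. *)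
have size_gt1 (i : 'I_n) : (1 < size_bound A b)%N.
  have : (0 < n)%N by exact: leq_ltn_trans (leq0n i) (ltn_ord i).
  by rewrite /size_bound; lia.
have psi_nondecreasing i : {in `[0, +oo[ &, nondecreasing_fun (psi i)}.
  by apply: pwl_nondecreasing => //; exact: size_gt1.
have psi_concave i : concave_function `[0, +oo[%classic (psi i).
  by apply: pwl_concave => //; exact: size_gt1.
have feasX : exists x, feasible (map_mx ratr A) (map_mx ratr b) (x : 'cV[R]_n).
  by case: X_neq0 => x /polyhedronE; exists x.
have [v vb vmin] :=
  exists_basic_solution_min phi_nondecreasing phi_concave feasX.
have [w wb wmin] :=
  exists_basic_solution_min psi_nondecreasing psi_concave feasX.
exists (separable phi v), (separable psi w); split.
- split; first by exists v => //; apply/polyhedronE; case: vb.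
  by move=> _ [y /polyhedronE yX <-]; exact: vmin.
- split; first by exists w => //; apply/polyhedronE; case: wb.
  by move=> _ [y /polyhedronE yX <-]; exact: wmin.
- apply: (le_trans (vmin w wb.1)); apply: ler_sum => i _.
  by apply: le_pwl => //; [exact: size_gt1|exact: (wb.1 (inr i))].
(* The minimizer [v] of [phi] serves as a test point for [psi]: its coordinates are 0, where both
   functions agree, or lie within the grid. *)
- apply: (le_trans (wmin v vb.1)); rewrite mulr_sumr; apply: ler_sum => i _.
  have phi0 := phi_ge0 i 0 (lexx 0).
  have [->|vi] := eqVneq (v i 0) 0.
    by rewrite /psi /pwl eqxx ler_peMl// lerDl ltW.
  have [lo hi] := basic_solution_bound vb vi.
  by apply: pwl_le => //; exact: size_gt1.
Qed.
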